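(* For each $d\in\{2,3\}$ there exist an energy $E>0$, an incident vector $k\in\mathbb{S}^{d-1}_\kappa$ (where $\kappa=\sqrt E$), and two different multipoint potentials of Bethe–Peierls–Thomas–Fermi type in $\mathbb{R}^d$, $\nu=\sum_{j=1}^{n}\delta_{\alpha_j}(x-y_j)$ and $\tilde\nu=\sum_{j=1}^{\tilde n}\delta_{\tilde\alpha_j}(x-\tilde y_j)$ (with $\alpha_j,\tilde\alpha_j\in\mathbb{C}$, with $y_1,\dots,y_n\in\mathbb{R}^d$ mutually distinct and $\tilde y_1,\dots,\tilde y_{\tilde n}\in\mathbb{R}^d$ mutually distinct), i.e. with $\{(y_j,\alpha_j):1\le j\le n\}\neq\{(\tilde y_j,\tilde\alpha_j):1\le j\le\tilde n\}$, whose matrices satisfy $\det A(\kappa)\ne0$ and $\det\tilde A(\kappa)\neq0$, and whose scattering amplitudes at energy $E$ satisfy $f^+(k,l)=\tilde f^+(k,l)$ for all $l\in\mathbb{S}^{d-1}_\kappa$. That is, such a potential is in general not uniquely determined by its scattering amplitude $f^+(k,\cdot)$ at a positive energy $E$ and a fixed incident vector $k$.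
   Context: Notation: $\mathbb{S}^{d-1}_\kappa=\{x\in\mathbb{R}^d:|x|=\kappa\}$. Multipoint potentials. A multipoint potential of Bethe–Peierls–Thomas–Fermi type in $\mathbb{R}^d$, $d=2,3$, is a formal sum $\nu(x)=\sum_{j=1}^n\delta_{\alpha_j}(x-y_j)$, $\alpha_j\in\mathbb{C}$, $y_j\in\mathbb{R}^d$ mutually distinct; it is identified with the finite set of pairs $\{(y_j,\alpha_j)\}$. The case $\nu\equiv0$ is the case $n=0$. A function $\psi$ solves $-\Delta\psi+\nu\psi=E\psi$ if $-\Delta\psi=E\psi$ on $\mathbb{R}^d\setminus\{y_1,\dots,y_n\}$ and, as $x\to y_j$: for $d=2$, $\psi(x)=\psi_{j,-1}\ln|x-y_j|+\psi_{j,0}+O(|x-y_j|)$ with $\psi_{j,0}=(-2\pi\alpha_j-\ln2+\gamma)\psi_{j,-1}$ ($\gamma$ is Euler's constant); for $d=3$, $\psi(x)=\psi_{j,-1}/|x-y_j|+\psi_{j,0}+O(|x-y_j|)$ with $4\pi\alpha_j\psi_{j,-1}=\psi_{j,0}$. Scattering amplitude. Let $\kappa=\sqrt E>0$. For $k\in\mathbb{S}^{d-1}_\kappa$ the scattering eigenfunction is the solution $\psi^+(x,k)=e^{ik\cdot x}+\psi^{sc}(x,k)$ with $|x|^{(d-1)/2}(\partial_{|x|}-i\kappa)\psi^{sc}\to0$ as $|x|\to\infty$ uniformly in $x/|x|$, and the scattering amplitude $f^+$ on $\mathbb{S}^{d-1}_\kappa\times\mathbb{S}^{d-1}_\kappa$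 is defined by $\psi^{sc}(x,k)=\frac{e^{i\kappa|x|}}{|x|^{(d-1)/2}}f^+(k,\kappa x/|x|)+O(|x|^{-(d+1)/2})$. Explicitly (these known formulas may be taken as the definition of $\psi^+$ and $f^+$): let $$G^+(x,\kappa)=-\tfrac i4H_0^1(\kappa|x|)\ (d=2),\qquad G^+(x,\kappa)=-\frac{e^{i\kappa|x|}}{4\pi|x|}\ (d=3),$$ where $H_0^1$ is the zeroth-order Hankel function of the first kind. Let $A(\kappa)$ be the $n\times n$ matrix with $A_{j,j}(\kappa)=\alpha_j-\frac1{4\pi}(\pi i-2\ln\kappa)$ if $d=2$, $A_{j,j}(\kappa)=\alpha_j-\frac{i\kappa}{4\pi}$ if $d=3$, and $A_{j,j'}(\kappa)=G^+(y_j-y_{j'},\kappa)$ for $j\ne j'$. Assuming $\det A(\kappa)\ne0$ (for $n=0$ this condition is void), let $q(k)=(q_1(k),\dots,q_n(k))^t$ be the solution of $A(\kappa)q(k)=-(e^{ik\cdot y_1},\dots,e^{ik\cdot y_n})^t$. Then, for $k,l\in\mathbb{S}^{d-1}_\kappa$, $$\psi^+(x,k)=e^{ik\cdot x}+\sum_{j=1}^nq_j(k)G^+(x-y_j,\kappa),\qquad f^+(k,l)=\frac{c(d,\kappa)}{(2\pi)^d}\sum_{j=1}^nq_j(k)e^{-il\cdot y_j},$$ with $c(d,\kappa)=-\pi i(\sqrt{2\pi}e^{-i\pi/4})^{d-1}\kappa^{(d-3)/2}$. For $\tilde\nu$ the objects $\tilde A,\tilde q,\tilde f^+$ are defined in the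 same way from $\tilde n,\tilde\alpha_j,\tilde y_j$. *)

(* Defs.v *)
From HB Require Import structures.
From mathcomp Require Import all_boot all_order all_algebra.
From mathcomp Require Import all_classical all_reals all_analysis.
From mathcomp Require Import complex.
Set Implicit Arguments.
Unset Strict Implicit.
Unset Printing Implicit Defensive.
Import Order.TTheory GRing.Theory Num.Theory.
Import numFieldNormedType.Exports.
Local Open Scope classical_set_scope.
Local Open Scope complex_scope.
Local Open Scope ring_scope.

Section Geometry.
Variables (R : realType) (d : nat).
Implicit Types x y : 'rV[R]_d.

Definition dot x y : R := \sum_(i < d) x 0 i * y 0 i.

(* The norm that the library puts on 'rV[R]_d is the sup norm; the Euclidean
   one is needed here. *)
Definition enorm x : R := Num.sqrt (dot x x).

Definition esphere (r : R) : set 'rV[R]_d := [set x | enorm x = r].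

End Geometry.
Arguments esphere {R d} r _.

Section SpecialFunctions.
Variable R : realType.
Implicit Types t x : R.

(* expi t = e^{it} *)
Definition expi t : R[i] := cos t +i* sin t.

(* series harmonic n is the harmonic number H_n = 1 + 1/2 + ... + 1/n. *)
Definition euler_gamma : R :=
  limn (fun n : nat => series harmonic n - ln (n%:R : R)).

Definition besselJ0 x : R :=
  limn (series (fun m : nat => (-1) ^+ m * (x / 2) ^+ (2 * m) / m`!%:R ^+ 2)).

(* The classical expansion of the Bessel function of the second kind:
   (2/pi) (ln(x/2) + gamma) J_0(x)
     + (2/pi) sum_(m >= 1) (-1)^(m+1) H_m (x/2)^(2m) / (m!)^2,  for x > 0.
   The term m = 0 of the series below vanishes since H_0 = 0. *)
Definition besselY0 x : R :=
  2 / pi * (ln (x / 2) + euler_gamma) * besselJ0 x +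
  2 / pi * limn (series (fun m : nat =>
    (-1) ^+ m.+1 * series harmonic m * (x / 2) ^+ (2 * m) / m`!%:R ^+ 2)).

Definition hankel1_0 x : R[i] := besselJ0 x +i* besselY0 x.

End SpecialFunctions.

(* The formal sum of the delta_{alpha_j}(x - y_j), for j < n. *)
Record multipoint (R : realType) (d : nat) := Multipoint {
  npoints : nat;
  site : 'I_npoints -> 'rV[R]_d;
  strength : 'I_npoints -> R[i];
  site_inj : injective site
}.
Arguments site {R d} m _.
Arguments strength {R d} m _.
Arguments site_inj {R d} m.

(* Two records denote the same potential iff these sets coincide: the order of
   the points is immaterial. *)
Definition potential_set (R : realType) (d : nat) (nu : multipoint R d) :
    set ('rV[R]_d * R[i]) :=
  range (fun j => (site nu j, strength nu j)).

(* The definitions below are meant for d = 2 and d = 3 only: the `else' branch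
   of a test `d == 2' is the case d = 3. *)
Section Scattering.
Variables (R : realType) (d : nat).

(* G^+(x, kappa), for x != 0 *)
Definition green (kappa : R) (x : 'rV[R]_d) : R[i] :=
  if d == 2%N then - ('i%C / 4) * hankel1_0 (kappa * enorm x)
  else - (expi (kappa * enorm x) / (4 * pi * enorm x)%:C).

Definition Adiag (kappa : R) (alpha : R[i]) : R[i] :=
  if d == 2%N then alpha - ((4 * pi)^-1)%:C * (pi%:C * 'i%C - (2 * ln kappa)%:C)
  else alpha - 'i%C * (kappa / (4 * pi))%:C.

Definition Amx (kappa : R) (nu : multipoint R d) : 'M[R[i]]_(npoints nu) :=
  \matrix_(j, j') if j == j' then Adiag kappa (strength nu j)
                  else green kappa (site nu j - site nu j').

(* The solution of A(kappa) q = - (e^{i k.y_j})_j when det A(kappa) != 0. *)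
Definition qvec (kappa : R) (nu : multipoint R d) (k : 'rV[R]_d) :
    'cV[R[i]]_(npoints nu) :=
  invmx (Amx kappa nu) *m - (\col_j expi (dot k (site nu j))).

(* c(d, kappa) = - pi i (sqrt(2 pi) e^{-i pi/4})^(d-1) kappa^((d-3)/2) *)
Definition cdk (kappa : R) : R[i] :=
  - (pi%:C * 'i%C) * ((Num.sqrt (2 * pi))%:C * expi (- (pi / 4))) ^+ d.-1
  * (kappa `^ ((d%:R - 3) / 2))%:C.

(* f^+(k, l) at the energy E = kappa^2, when det A(kappa) != 0 *)
Definition scat_amp (kappa : R) (nu : multipoint R d) (k l : 'rV[R]_d) : R[i] :=
  cdk kappa / ((2 * pi) ^+ d)%:C *
  \sum_(j < npoints nu) qvec kappa nu k j 0 * expi (- dot l (site nu j)).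

End Scattering.

(* Main.v *)
(** A point whose coefficient q_j vanishes is invisible in the scattering
    amplitude, whatever its strength.  For two points y0, y1 with
    g = G^+(y0 - y1) <> 0, the vector q = (- e^{ik.y1} / g, 0) solves
    A q = - (e^{ik.y0}, e^{ik.y1}) as soon as A_00 = g e^{ik.y0} / e^{ik.y1};
    the strength at y1 then remains free, up to det A <> 0. *)
Require Import Defs.
From mathcomp Require Import all_boot all_order all_algebra.
From mathcomp Require Import all_classical all_reals all_analysis complex.
From mathcomp Require Import ring lra.
Import Order.TTheory GRing.Theory Num.Theory.
Import numFieldNormedType.Exports.
Local Open Scope classical_set_scope.
Local Open Scope ring_scope.

Lemma expi_neq0 (R : realType) (t : R) : expi t != 0.
Proof.
apply/eqP => -[c0 s0]; have := cos2Dsin2 t.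
by rewrite c0 s0 expr0n addr0 => /esym/eqP; rewrite oner_eq0.
Qed.

Lemma enormN (R : realType) (d : nat) (x : 'rV[R]_d) : enorm (- x) = enorm x.
Proof.
by congr Num.sqrt; apply: eq_bigr => i _; rewrite !mxE mulrNN.
Qed.

Lemma enorm_delta (R : realType) (d : nat) (i : 'I_d) :
  enorm (delta_mx 0 i : 'rV[R]_d) = 1.
Proof.
rewrite /enorm /dot (bigD1 i) //= big1 ?addr0 => [|j /negbTE ji].
  by rewrite !mxE !eqxx mulr1 sqrtr1.
by rewrite !mxE ji andbF mulr0.
Qed.

(** G^+ is radial; hence both off-diagonal entries of a 2 x 2 matrix A are the same g. *)
Lemma green_sym (R : realType) (d : nat) (kappa : R) (x y : 'rV[R]_d) :
  green kappa (x - y) = green kappa (y - x).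
Proof. by rewrite /green -(opprB y x) enormN. Qed.

(** [Adiag] is a translation in the strength, so the diagonal of A can be prescribed at will. *)
Lemma AdiagE (R : realType) (d : nat) (kappa : R) (a : R[i]) :
  Adiag d kappa (a - Adiag d kappa 0) = a.
Proof. by rewrite /Adiag; case: (d == 2%N); rewrite sub0r opprK addrK. Qed.

(** At x = 1 the term of index m is at most 4^(-m) in modulus and the first one is 1, so the sum is
    at least 1 - 1/3. *)
Lemma besselJ0_1_gt0 (R : realType) : 0 < besselJ0 (1 : R).
Proof.
rewrite /besselJ0; set u := (fun m : nat => _).
have u_le m : `|u m| <= geometric 1 (4^-1 : R) m.
  rewrite /u /= normrM normfV normrM !normrX normrN1 expr1n !mul1r.
  rewrite exprM normfV !normr_nat exprVn -!natrX ler_pdivrMr.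
    by rewrite ler_peMr ?exprn_ge0 ?invr_ge0 // ler1n expn_gt0 fact_gt0.
  by rewrite ltr0n expn_gt0 fact_gt0.
have cu : cvgn (series u).
  apply: normed_cvg; apply: (series_le_cvg _ _ u_le) => [n|n|].
  - exact: normr_ge0.
  - exact: le_trans (normr_ge0 _) (u_le n).
  - by apply: is_cvg_geometric_series; rewrite ger0_norm; lra.
have u0 : u 0%N = 1 by rewrite /u muln0 !expr0 fact0 expr1n invr1 !mulr1.
(* The tail of the geometric bound sums to 1/3. *)
have lower n : 2 / 3 + (3^-1 * 4 * 4^-1 ^+ n.+1) <= series u n.+1.
  rewrite seriesEnat /=; elim: n => [|n IHn].
    by rewrite big_nat1 u0 expr1; lra.
  rewrite big_nat_recr //=; move: IHn (u_le n.+1); rewrite /= mul1r ler_norml.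
  rewrite [4^-1 ^+ n.+2]exprS => IHn /andP[+ _]; lra.
apply: (@lt_le_trans _ _ (2 / 3)); first lra.
(* The empty partial sum is 0 and violates the bound, which therefore starts at index 1. *)
apply: limr_ge => //; exists 1%N => // -[//|n] _ /=.
by apply: le_trans (lower n); rewrite lerDl !mulr_ge0 ?exprn_ge0 ?invr_ge0.
Qed.

(** For d = 2, the real part of H_0^1(1) is J_0(1) > 0; otherwise G^+ is a phase divided by a
    nonzero real. *)
Lemma green_neq0 (R : realType) (d : nat) (x : 'rV[R]_d) :
  enorm x = 1 -> green 1 x != 0.
Proof.
move=> x1; rewrite /green x1 !mulr1; case: ifP => _.
  rewrite mulf_neq0 ?oppr_eq0 ?mulf_neq0 ?invr_eq0 ?pnatr_eq0 ?neq0Ci //.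
  by apply/eqP => -[] /eqP; rewrite gt_eqF ?besselJ0_1_gt0.
rewrite oppr_eq0 mulf_neq0 ?expi_neq0 // invr_eq0.
by apply/eqP => -[]; apply/eqP; rewrite mulf_neq0 ?pnatr_eq0 ?gt_eqF ?pi_gt0.
Qed.

Lemma ord2_neq0 (i : 'I_2) : i <> 0 -> i = 1.
Proof.
by case: i => [[|[|?]] ?] // i0; [case: i0|]; apply/val_inj.
Qed.

Section InvisiblePoint.
Variables (R : realType) (d : nat) (kappa : R) (k y0 y1 : 'rV[R]_d).
Hypothesis y01 : y0 != y1.

Let g : R[i] := green kappa (y0 - y1).
Hypothesis g_neq0 : g != 0.

Let a0 : R[i] := g * expi (dot k y0) / expi (dot k y1).

Let two_site (j : 'I_2) : 'rV[R]_d := if j == 0 then y0 else y1.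

Lemma two_site_inj : injective two_site.
Proof.
by apply/injectiveP; rewrite /injectiveb /dinjectiveb enum_ordSl enum_ordSl
  enum_ord0 /= inE /two_site /= y01.
Qed.

(** The shift by [Adiag d kappa 0] makes [a0] and [a] the diagonal entries of A, not the
    strengths. *)
Definition two_points (a : R[i]) : multipoint R d :=
  @Multipoint R d 2 two_site
    (fun j => (if j == 0 then a0 else a) - Adiag d kappa 0) two_site_inj.

Lemma Amx_two_points a : Amx kappa (two_points a) =
  \matrix_(i < 2, j < 2) if i == j then (if i == 0 then a0 else a) else g.
Proof.
apply/matrixP => i j; rewrite !mxE; case: eqP => ij /=; first by rewrite AdiagE.
rewrite /two_site; case: eqP => i0; case: eqP => j0 //.
- by case: ij; rewrite i0 j0.
- by rewrite green_sym.
- by case: ij; rewrite (ord2_neq0 i i0) (ord2_neq0 j j0).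
Qed.

Lemma det_two_points a : \det (Amx kappa (two_points a)) = a0 * a - g ^+ 2.
Proof.
rewrite Amx_two_points (expand_det_row _ 0) !big_ord_recl big_ord0 addr0.
by rewrite /cofactor !det_mx11 !mxE /=; ring.
Qed.

Lemma qvec_two_points a : \det (Amx kappa (two_points a)) != 0 ->
  qvec kappa (two_points a) k =
  \col_(j < 2) if j == 0 then - (expi (dot k y1) / g) else 0.
Proof.
move=> dA; rewrite /qvec; set b := - _; set q := \col__ _.
(* Row 0 holds by the choice of [a0], row 1 because g cancels; [a] only meets the zero entry of
   q. *)
have -> : b = Amx kappa (two_points a) *m q.
  rewrite Amx_two_points; apply/matrixP => i j; rewrite !mxE /= /two_site.
  rewrite !big_ord_recl big_ord0 !mxE /= mulr0 !addr0.
  case: eqP => [_|_]; rewrite /a0; field; rewrite ?g_neq0 ?expi_neq0 //.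
by rewrite mulKmx // unitmxE unitfE.
Qed.

Lemma scat_amp_two_points a b l :
  \det (Amx kappa (two_points a)) != 0 -> \det (Amx kappa (two_points b)) != 0 ->
  scat_amp kappa (two_points a) k l = scat_amp kappa (two_points b) k l.
Proof.
by move=> da db; rewrite /scat_amp (qvec_two_points _ da) (qvec_two_points _ db).
Qed.

(** As y0 differs from y1, a single pair of each set has site y1, and its strength determines the
    parameter. *)
Lemma potential_set_two_points_inj a b :
  potential_set (two_points a) = potential_set (two_points b) -> a = b.
Proof.
move=> ab; have : potential_set (two_points a) (y1, a - Adiag d kappa 0).
  by exists 1.
rewrite ab => -[j _] /= []; rewrite /two_site; case: eqP => _.
  by move=> /eqP; rewrite (negbTE y01).
by move=> _ /addIr.
Qed.

Lemma exists_same_scat_amp : exists nu nu' : multipoint R d,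
  [/\ potential_set nu <> potential_set nu',
      \det (Amx kappa nu) != 0, \det (Amx kappa nu') != 0 &
      forall l, scat_amp kappa nu k l = scat_amp kappa nu' k l].
Proof.
have a0_neq0 : a0 != 0 by rewrite !mulf_neq0 ?invr_eq0 ?expi_neq0.
have d0 : \det (Amx kappa (two_points 0)) != 0.
  by rewrite det_two_points mulr0 sub0r oppr_eq0 expf_neq0.
(* This value turns a0 a - g^2 into g^2, while a = 0 gives -g^2. *)
have d1 : \det (Amx kappa (two_points (2 * g ^+ 2 / a0))) != 0.
  rewrite det_two_points mulrC divfK // mulr_natl mulr2n addrK.
  by rewrite expf_neq0.
exists (two_points 0), (two_points (2 * g ^+ 2 / a0)); split => //.
  move=> /potential_set_two_points_inj/esym/eqP; apply/negP.
  by rewrite !mulf_neq0 ?invr_eq0 ?pnatr_eq0 ?expf_neq0.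
by move=> l; apply: scat_amp_two_points.
Qed.

End InvisiblePoint.

Theorem theorem3p3 (R : realType) (d : nat) (hd : d = 2%N \/ d = 3%N) :
  exists (E : R) (k : 'rV[R]_d) (nu nu' : multipoint R d),
    let kappa := Num.sqrt E in
    0 < E /\
    esphere kappa k /\
    potential_set nu <> potential_set nu' /\
    \det (Amx kappa nu) != 0 /\
    \det (Amx kappa nu') != 0 /\
    (forall l : 'rV[R]_d, esphere kappa l ->
       scat_amp kappa nu k l = scat_amp kappa nu' k l).
Proof.
have d_gt0 : (0 < d)%N by case: hd => ->.
(* With E = kappa = 1, the unit vector e serves both as k and as the site y0, and y1 = 0; the sites
   are then at distance 1, as [green_neq0] requires. *)
pose e : 'rV[R]_d := delta_mx 0 (Ordinal d_gt0).
have e1 : enorm e = 1 by exact: enorm_delta.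
have e_neq0 : e != 0.
  apply/eqP => /matrixP/(_ 0 (Ordinal d_gt0))/eqP.
  by rewrite !mxE !eqxx oner_eq0.
have g_neq0 : green 1 (e - 0) != 0 by rewrite subr0 green_neq0.
have [nu [nu' [neq d0 d1 same]]] := exists_same_scat_amp R d 1 e e 0 e_neq0 g_neq0.
by exists 1, e, nu, nu'; rewrite /= sqrtr1.
Qed.
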